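(* The simultaneous Post Correspondence Problem is decidable for marked morphisms of free monoids. That is, there exists an algorithm which, given finite alphabets $\Sigma,\Delta$ and a finite set $S$ of marked morphisms from $\Sigma^*$ to $\Delta^*$, decides whether $\operatorname{Eq}(S)$ is trivial, i.e. whether $\operatorname{Eq}(S)$ consists only of the empty word.
   Context: $\Sigma^*$ is the free monoid on $\Sigma$. A monoid morphism $f:\Sigma^*\to\Delta^*$ is marked if $f(a)$ is a non-empty word for every $a\in\Sigma$ and, for distinct $a,b\in\Sigma$, the words $f(a)$ and $f(b)$ start with different letters of $\Delta$. For morphisms $g,h:\Sigma^*\to\Delta^*$ put $\operatorname{Eq}(g,h)=\{x\in\Sigma^*\mid g(x)=h(x)\}$, and for a set $S$ of morphisms $\Sigma^*\to\Delta^*$ put $\operatorname{Eq}(S)=\bigcap_{g,h\in S}\operatorname{Eq}(g,h)$. A morphism $f:\Sigma^*\to\Delta^*$ is given as the list of words $(f(a))_{a\in\Sigma}$. *)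

(* Defs.v *)
From HB Require Import structures.
From Stdlib Require List.
From mathcomp Require Import all_boot.

Set Implicit Arguments.
Unset Strict Implicit.
Unset Printing Implicit Defensive.

(* [seq T] carries no monoid structure in the library; the alias keeps the     *)
(* concatenation structure off the general type of sequences.                  *)
Definition free_monoid (T : choiceType) : Type := seq T.

HB.instance Definition _ (T : choiceType) := Choice.copy (free_monoid T) (seq T).
HB.instance Definition _ (T : choiceType) :=
  isMonoid.Build (free_monoid T) (@catA T) (@cat0s T) (@cats0 T).

Definition morphism (Sigma Delta : choiceType) : Type :=
  UMagmaMorphism.type (free_monoid Sigma) (free_monoid Delta).

Definition gen (T : choiceType) (a : T) : free_monoid T := [:: a].

Definition marked (Sigma Delta : choiceType) (f : morphism Sigma Delta) : Prop :=
  (forall a : Sigma, f (gen a) <> [::]) /\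
  (forall a b : Sigma, a <> b -> ohead (f (gen a)) <> ohead (f (gen b))).

Definition Eq (Sigma Delta : choiceType) (g h : morphism Sigma Delta)
    (x : free_monoid Sigma) : Prop :=
  g x = h x.

(* A finite set of morphisms is presented by a list enumerating it; the order  *)
(* of the list and possible repetitions are irrelevant. For the empty list the *)
(* intersection is the whole free monoid.                                      *)
Definition EqS (Sigma Delta : choiceType) (S : seq (morphism Sigma Delta))
    (x : free_monoid Sigma) : Prop :=
  forall g h, List.In g S -> List.In h S -> Eq g h x.

Definition EqS_trivial (Sigma Delta : choiceType)
    (S : seq (morphism Sigma Delta)) : Prop :=
  forall x : free_monoid Sigma, EqS S x <-> x = [::].

(* Existence of a function to [bool] would not express decidability: with       *)
(* classical axioms every predicate has a characteristic function. An          *)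
(* algorithm is therefore a term [p : murec n] denoting a partial recursive    *)
(* function of [n] natural numbers, and [murec_eval p v y] says that the       *)
(* computation of [p] on the arguments [v] terminates with value [y].          *)
Inductive murec : nat -> Type :=
| MZero n : murec n
| MSucc : murec 1
| MProj n (i : 'I_n) : murec n
| MComp m n (f : murec m) (g : 'I_m -> murec n) : murec n
| MRec n (f : murec n) (g : murec n.+2) : murec n.+1
| MMin n (f : murec n.+1) : murec n.

Inductive murec_eval : forall n, murec n -> n.-tuple nat -> nat -> Prop :=
| eval_zero n (v : n.-tuple nat) : murec_eval (MZero n) v 0
| eval_succ x : murec_eval MSucc [tuple x] x.+1
| eval_proj n (i : 'I_n) (v : n.-tuple nat) :
    murec_eval (MProj i) v (tnth v i)
| eval_comp m n (f : murec m) (g : 'I_m -> murec n)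
    (v : n.-tuple nat) (w : m.-tuple nat) y :
    (forall i, murec_eval (g i) v (tnth w i)) -> murec_eval f w y ->
    murec_eval (MComp f g) v y
| eval_rec0 n (f : murec n) (g : murec n.+2) (v : n.-tuple nat) y :
    murec_eval f v y -> murec_eval (MRec f g) (cons_tuple 0 v) y
| eval_recS n (f : murec n) (g : murec n.+2) (v : n.-tuple nat) x z y :
    murec_eval (MRec f g) (cons_tuple x v) z ->
    murec_eval g (cons_tuple x (cons_tuple z v)) y ->
    murec_eval (MRec f g) (cons_tuple x.+1 v) y
  (* [t] supplies the nonzero (successor) values of [f] below the minimum [y] *)
| eval_min n (f : murec n.+1) (v : n.-tuple nat) y (t : nat -> nat) :
    (forall x, x < y -> murec_eval f (cons_tuple x v) (t x).+1) ->
    murec_eval f (cons_tuple y v) 0 ->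
    murec_eval (MMin f) v y.

(* Letters are numbered by their rank in the enumeration of the alphabet, and  *)
(* [CodeSeq.code] is the library's injective coding of [seq nat] by [nat].     *)
Definition encode_word (T : finType) (w : free_monoid T) : nat :=
  CodeSeq.code [seq nat_of_ord (enum_rank a) | a <- w].

Definition encode_morphism (Sigma Delta : finType) (f : morphism Sigma Delta) :
    nat :=
  CodeSeq.code [seq encode_word (f (gen a)) | a <- enum Sigma].

Definition encode_instance (Sigma Delta : finType)
    (S : seq (morphism Sigma Delta)) : nat :=
  CodeSeq.code [:: #|Sigma|; #|Delta|;
                   CodeSeq.code [seq encode_morphism f | f <- S]].

(* Main.v *)
Require Import Defs.
From mathcomp Require Import all_boot.

Set Implicit Arguments.
Unset Strict Implicit.
Unset Printing Implicit Defensive.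

(** The set Eq(S) is trivial as soon as it contains no short non-empty word,
    where short means at most an explicit primitive recursive function of
    the code of the instance.  Deciding triviality is then a bounded search.

    For one pair (g, h) of marked morphisms, call a solution primitive when no
    proper non-empty prefix of it is a solution.  Reading a common value
    w = g(x) = h(x) from left to right, cut w at every point where both
    factorizations end a letter.  The pieces between consecutive cuts come
    from blocks (u, v), minimal pairs with g(u) = h(v).  By markedness, every
    block is determined by its first letter in w (block_head_uniq): away from
    a cut, one of the two sides is ahead, and its excess forces the next
    letter of the other side.  Sending the first letter of a block to u,
    respectively v, gives a new marked pair (g', h'), and x is the common
    image of the word x' of first letters of its blocks, a primitive solution
    of the new pair (primitive_reduction).

    This reduction cannot produce longer and longer images.  Mapped by g into
    the common word, a proper suffix of u = g'(b) starts strictly inside some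
    h(c), hence is determined by a proper suffix of h(c) (block_suffix), so
    that the number of distinct proper suffixes of images does not grow when
    passing from h to g', nor from g to h'.  All pairs met along iterated reductions therefore belong to
    one finite set.  Since a pair and a first letter determine a primitive
    solution (primitive_uniq), and the length strictly decreases until it
    reaches 1, no (pair, first letter) is met twice.  As each step divides the
    length by a bounded factor at most, the length of primitive solutions is
    bounded (primitive_size).

    For several morphisms f_0, ..., f_k and a common solution x, cut each
    prefix of x after its longest prefix on which f_0 and f_j agree; what
    remains is shorter than a primitive solution for (f_0, f_j).  When x is
    too long, two prefixes have the same remainders for every j, and removing
    the factor between them gives a shorter common solution
    (short_solution).

    The search itself is written with compositions, primitive recursion and
    bounded sums over the numerical codes of words (recursive_verdict). *)

(** * Extending letter images to words *)

Section Extension.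
Variables T U : Type.
Implicit Types (g : T -> seq U) (x y : seq T).

Definition ext g x := flatten (map g x).

Lemma ext_cat g x y : ext g (x ++ y) = ext g x ++ ext g y.
Proof. by rewrite /ext map_cat flatten_cat. Qed.

Lemma ext_cons g a x : ext g (a :: x) = g a ++ ext g x.
Proof. by []. Qed.

End Extension.
Arguments ext : simpl never.

(** * Marked partial morphisms and their blocks *)

Section Words.
Variable A : eqType.
Implicit Types (g h : A -> seq A) (a b c : A).
Implicit Types (o p q r s t u v w x y z : seq A).

(** Reductions yield morphisms defined on part of the alphabet only; the empty
    word stands for an undefined image, which is unambiguous because marked
    morphisms are non-erasing. *)
Definition partial_marked g :=
  forall a b, g a != [::] -> ohead (g a) = ohead (g b) -> a = b.

Definition in_dom g x := all (fun a => g a != [::]) x.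

Lemma in_dom_cat g x y : in_dom g (x ++ y) = in_dom g x && in_dom g y.
Proof. exact: all_cat. Qed.

Lemma ext_nil g x : in_dom g x -> (ext g x == [::]) = (x == [::]).
Proof. by case: x => //= a x /andP[]; rewrite ext_cons; case: (g a). Qed.

Lemma cat_cancel w x y : w ++ x = w ++ y -> x = y.
Proof. by move/eqP; rewrite eqseq_cat // eqxx => /eqP. Qed.

Lemma cat_eq_cat s t s' t' : s ++ t = s' ++ t' ->
  (exists2 o, s = s' ++ o & t' = o ++ t) \/
  (exists2 o, s' = s ++ o & t = o ++ t').
Proof.
elim: s s' => [|a s IHs] [|b s'] /=.
- by move=> ->; left; exists [::].
- by move=> ->; right; exists (b :: s').
- by move=> <-; left; exists (a :: s).
by case=> -> /IHs[[o -> ->]|[o -> ->]]; [left|right]; exists o.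
Qed.

(** The state of a block read up to a point where [h] lags behind [g] by the
    word [o]: the pair (u, v) completes the block, and does so as soon as
    possible. *)
Definition pending g h o u v :=
  [/\ in_dom g u, in_dom h v, o ++ ext g u = ext h v &
   forall u1 u2 v1 v2, u = u1 ++ u2 -> v = v1 ++ v2 ->
     o ++ ext g u1 = ext h v1 -> u2 = [::] /\ v2 = [::]].

Lemma ohead_cat s t : s != [::] -> ohead (s ++ t) = ohead s.
Proof. by case: s. Qed.

(** The excess [o] forces the first letter of [v].  Consuming its image
    leaves either a shorter excess, or an excess on the other side, or a cut;
    hence the exchange of [g] and [h] along the induction. *)
Lemma pending_uniq g h o u v u' v' :
  partial_marked g -> partial_marked h -> o != [::] ->
  pending g h o u v -> pending g h o u' v' -> u = u' /\ v = v'.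
Proof.
move: {2}(size u + size v) (leqnn (size u + size v)) => n.
elim: n g h o u v u' v' => [|n IHn] g h o u v u' v' len mg mh o0.
  move: len; rewrite leqn0 addn_eq0 !size_eq0 => /andP[/eqP-> /eqP->].
  by case=> _ _; rewrite /ext /= cats0 => /eqP; rewrite (negPf o0).
case: v len => [|c v] len [su sv eq mn].
  by case/eqP: (o0); case: (o) eq.
case: v' => [|c' v'] [su' sv' eq' mn'].
  by case/eqP: (o0); case: (o) eq'.
case/andP: (sv) => hc sv1; case/andP: (sv') => hc' sv1'.
have Ec : c = c'.
  apply: mh => //.
  rewrite -(ohead_cat (ext h v) hc) -(ohead_cat (ext h v') hc').
  by rewrite -!ext_cons -eq -eq' !ohead_cat.
subst c'; move: (eq) (eq'); rewrite !ext_cons => e e'.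
case: (cat_eq_cat e) => [[o' Eo Ev]|[o' Eo Eu]].
  have [o'0|o'N] := eqVneq o' [::].
    have cut : o ++ ext g [::] = ext h [:: c].
      by rewrite Eo o'0 ext_cons /ext /= cats0.
    have [-> ->] := mn [::] u [:: c] v erefl erefl cut.
    by have [-> ->] := mn' [::] u' [:: c] v' erefl erefl cut.
  have Ev' : ext h v' = o' ++ ext g u'.
    by move: e'; rewrite Eo -catA => /cat_cancel.
  have [] := IHn g h o' u v u' v' _ mg mh o'N.
  - by move: len; rewrite /= addnS.
  - split=> // u1 u2 v1 v2 Eu1 Ev1 cut.
    apply: (mn u1 u2 (c :: v1) v2) => //; first by rewrite Ev1.
    by rewrite Eo -catA cut.
  - split=> // u1 u2 v1 v2 Eu1 Ev1 cut.
    apply: (mn' u1 u2 (c :: v1) v2) => //; first by rewrite Ev1.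
    by rewrite Eo -catA cut.
  by move=> -> ->.
have [o'0|o'N] := eqVneq o' [::].
  have cut : o ++ ext g [::] = ext h [:: c].
    by rewrite ext_cons Eo o'0 /ext /= !cats0.
  have [-> ->] := mn [::] u [:: c] v erefl erefl cut.
  by have [-> ->] := mn' [::] u' [:: c] v' erefl erefl cut.
have Eu' : ext g u' = o' ++ ext h v'.
  by move: e'; rewrite Eo -catA => /cat_cancel.
have [] := IHn h g o' v u v' u' _ mh mg o'N.
- by move: len; rewrite /= addnS addnC.
- split=> // u1 u2 v1 v2 Eu1 Ev1 cut.
  have [] := mn v1 v2 (c :: u1) u2; rewrite ?Ev1 ?Eu1 //.
  by rewrite ext_cons Eo -cut catA.
- split=> // u1 u2 v1 v2 Eu1 Ev1 cut.
  have [] := mn' v1 v2 (c :: u1) u2; rewrite ?Ev1 ?Eu1 //.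
  by rewrite ext_cons Eo -cut catA.
by move=> -> ->.
Qed.

(** Minimality asks for a non-empty common image rather than for non-empty
    prefixes, to keep the notion symmetric in (g, u) and (h, v). *)
Record block g h u v : Prop := Block {
  block_doml : in_dom g u;
  block_domr : in_dom h v;
  block_eq : ext g u = ext h v;
  block_neq0 : ext g u != [::];
  block_min : forall u1 u2 v1 v2, u = u1 ++ u2 -> v = v1 ++ v2 ->
    ext g u1 = ext h v1 -> ext g u1 != [::] -> u2 = [::] /\ v2 = [::] }.

Lemma block_sym g h u v : block g h u v -> block h g v u.
Proof.
case=> su sv e n0 mn; split=> //; first by rewrite -e.
move=> v1 v2 u1 u2 Ev Eu cut ne.
by have [] := mn u1 u2 v1 v2 Eu Ev (esym cut); rewrite // -cut.
Qed.

(** The first letter of the common image determines the first letter of [u],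
    whose image is then the excess over the empty prefix of [v]. *)
Lemma block_head_uniq g h u v u' v' : partial_marked g -> partial_marked h ->
  block g h u v -> block g h u' v' -> ohead (ext g u) = ohead (ext g u') ->
  u = u' /\ v = v'.
Proof.
move=> mg mh [su sv e n0 mn] [su' sv' e' n0' mn'].
case: u su e n0 mn => //= a u /andP[ga su] e _ mn.
case: u' su' e' n0' mn' => //= a' u' /andP[ga' su'] e' _ mn'.
rewrite !ext_cons !ohead_cat // => /(mg _ _ ga) Ea; subst a'.
have P w z : in_dom g w -> in_dom h z -> ext g (a :: w) = ext h z ->
    (forall u1 u2 v1 v2, a :: w = u1 ++ u2 -> z = v1 ++ v2 ->
     ext g u1 = ext h v1 -> ext g u1 != [::] -> u2 = [::] /\ v2 = [::]) ->
    pending g h (g a) w z.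
  move=> sw sz ez mz; split=> // u1 u2 v1 v2 Ew Ez cut.
  apply: (mz (a :: u1) u2 v1 v2) => //; first by rewrite Ew.
  by rewrite ext_cons; case: (g a) ga.
have Puv' := P u' v' su' sv' e' mn'.
by have [-> ->] := pending_uniq mg mh ga (P u v su sv e mn) Puv'.
Qed.

(** The dichotomy on which suffix counting rests: a point in the image of a
    word is either the end of a letter or strictly inside the image of one. *)
Lemma ext_cut h v s t : ext h v = s ++ t ->
  (exists v1 v2, [/\ v = v1 ++ v2, ext h v1 = s & ext h v2 = t]) \/
  (exists v1 c v2 r o, [/\ v = v1 ++ c :: v2, h c = r ++ o, r != [::],
     o != [::] & s = ext h v1 ++ r /\ t = o ++ ext h v2]).
Proof.
elim: v s t => [|c v IHv] s t.
  by case: s t => // -[|//] _; left; exists [::], [::].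
rewrite ext_cons => e; case: (cat_eq_cat e) => [[o Ec Et]|[o Es Ev]].
  have [s0|sN] := eqVneq s [::].
    by left; exists [::], (c :: v); split; rewrite ?s0 // ext_cons e s0.
  have [o0|oN] := eqVneq o [::].
    left; exists [:: c], v; split=> //; last by rewrite Et o0.
    by rewrite ext_cons Ec o0 /ext /= !cats0.
  by right; exists [::], c, v, s, o; split.
case: (IHv _ _ Ev) => [[v1 [v2 [-> E1 E2]]]|].
  by left; exists (c :: v1), v2; split=> //; rewrite ext_cons E1 Es.
case=> v1 [c' [v2 [r [o' [-> E1 r0 o0 [E2 E3]]]]]].
right; exists (c :: v1), c', v2, r, o'; split=> //; split=> //.
by rewrite Es E2 ext_cons catA.
Qed.

(** There is no cut inside a block, so a suffix of [u] starts strictly inside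
    the image of a letter under [h]; the rest [o] of that image is the excess
    that determines the suffix. *)
Lemma block_suffix g h u v p y : block g h u v -> u = p ++ y ->
  p != [::] -> y != [::] ->
  exists c r o q, [/\ h c = r ++ o, r != [::], o != [::] & pending h g o q y].
Proof.
case=> su sv e n0 mn Eu p0 y0.
move: (su); rewrite Eu in_dom_cat => /andP[sp sy].
have ep0 : ext g p != [::] by rewrite ext_nil.
have e' : ext h v = ext g p ++ ext g y by rewrite -ext_cat -Eu.
case: (ext_cut e') => [[v1 [v2 [Ev E1 E2]]]|].
  by have [yE] := mn p y v1 v2 Eu Ev (esym E1) ep0; rewrite yE in y0.
case=> v1 [c [q [r [o [Ev E1 r0 o0 [E2 E3]]]]]].
exists c, r, o, q; split=> //; split=> //.
  by move: sv; rewrite Ev in_dom_cat /= => /and3P[].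
move=> q1 q2 y1 y2 Eq Ey cut.
have [] := mn (p ++ y1) y2 (v1 ++ c :: q1) q2; rewrite ?ext_cat ?ext_cons //.
- by rewrite Eu Ey catA.
- by rewrite Ev Eq -catA.
- by rewrite E1 -cut E2 !catA.
by case: (ext g p) ep0.
Qed.

(** The suffix complexity of [g], its number of distinct proper non-empty
    suffixes of letter images, is at most [n]. *)
Definition suffixes_bounded g n := forall Y : seq (seq A), uniq Y ->
  (forall y, y \in Y -> exists a r, [/\ g a = r ++ y, r != [::] & y != [::]]) ->
  size Y <= n.

(** By [block_suffix] each suffix for [g'] is related to a suffix for [h],
    and by [pending_uniq] no two are related to the same one.  The hypothesis
    on [g'] makes every image the first half of a block. *)
Lemma suffixes_bounded_transfer g h (g' : A -> seq A) n :
  partial_marked g -> partial_marked h ->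
  (forall c, g' c != [::] -> exists v, block g h (g' c) v) ->
  suffixes_bounded h n -> suffixes_bounded g' n.
Proof.
move=> mg mh bl bd Y uY hY.
pose R y o := o != [::] /\
  exists c r q, [/\ h c = r ++ o, r != [::] & pending h g o q y].
suff [O [uO sO hO]] : exists O, [/\ uniq O, size O = size Y &
    forall o, o \in O -> exists2 y, y \in Y & R y o].
  rewrite -sO; apply: bd => // o /hO[y _ [o0 [c [r [q [E r0 _]]]]]].
  by exists c, r.
have tot y : y \in Y -> exists o, R y o.
  case/hY=> a [r [E r0 y0]].
  have a0 : g' a != [::] by rewrite E; case: (r) r0.
  have [v B] := bl a a0.
  have [c [r' [o [q [E1 r'0 o0 pe]]]]] := block_suffix B E r0 y0.
  by exists o; split=> //; exists c, r', q.
elim: Y uY tot {hY} => [|y Y IHY] /=; first by exists [::].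
case/andP=> yY uY tot.
have [z zY|O [uO sO hO]] := IHY uY; first by apply: tot; rewrite inE zY orbT.
have [o Ro] := tot y (mem_head _ _).
exists (o :: O); split=> /=; last 2 first.
- by rewrite sO.
- move=> o'; rewrite inE => /predU1P[->|/hO[z zY Rz]].
    by exists y => //; exact: mem_head.
  by exists z => //; rewrite inE zY orbT.
rewrite uO andbT; apply/negP=> /hO[z zY [_ [c [r [q [_ _ pz]]]]]].
have [o0 [c' [r' [q' [_ _ py]]]]] := Ro.
have [_ Ez] := pending_uniq mh mg o0 pz py.
by rewrite -Ez zY in yY.
Qed.

Lemma suffixes_bounded_size g n a : suffixes_bounded g n -> size (g a) <= n.+1.
Proof.
move=> bd; case E: (g a) => [|b w] //=; rewrite ltnS.
pose Y := [seq drop i w | i <- iota 0 (size w)].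
have -> : size w = size Y by rewrite size_map size_iota.
apply: bd => [|y].
  rewrite map_inj_in_uniq ?iota_uniq // => i j.
  rewrite !mem_iota !add0n /= => li lj /(congr1 size); rewrite !size_drop.
  by move=> e; rewrite -(subKn (ltnW li)) e subKn // ltnW.
case/mapP=> i; rewrite mem_iota add0n /= => li ->.
exists a, (b :: take i w); split=> //.
  by rewrite E /= cat_take_drop.
by rewrite -size_eq0 size_drop subn_eq0 -ltnNge.
Qed.

(** Cutting off the shortest non-empty pair of prefixes with the same image
    leaves a pair with the same property. *)
Lemma block_split g h u v : in_dom g u -> in_dom h v -> ext g u = ext h v ->
  exists bl : seq (seq A * seq A),
    [/\ forall b : seq A * seq A, b \in bl -> block g h b.1 b.2,
        u = flatten (map fst bl) & v = flatten (map snd bl)].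
Proof.
move: {2}(size u) (leqnn (size u)) => n.
elim: n u v => [|n IHn] u v len su sv e.
  move: len; rewrite leqn0 size_eq0 => /eqP u0; subst u.
  by exists [::]; split=> //; apply/eqP; rewrite -(ext_nil sv) -e.
have [u0|u0] := eqVneq u [::].
  by subst u; exists [::]; split=> //; apply/eqP; rewrite -(ext_nil sv) -e.
pose P i := (0 < i <= size u) &&
  [exists j : 'I_(size v).+1, ext g (take i u) == ext h (take j v)].
have exP : exists i, P i.
  exists (size u); rewrite /P lt0n size_eq0 u0 leqnn /=.
  by apply/existsP; exists ord_max; rewrite !take_size e.
case: (ex_minnP exP) => i /andP[/andP[i0 iu] /existsP[j /eqP eij]] mini.
have [sut sud] : in_dom g (take i u) /\ in_dom g (drop i u).
  by apply/andP; rewrite -in_dom_cat cat_take_drop.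
have [svt svd] : in_dom h (take j v) /\ in_dom h (drop j v).
  by apply/andP; rewrite -in_dom_cat cat_take_drop.
have B : block g h (take i u) (take j v).
  split=> //; first by rewrite ext_nil // -size_eq0 size_takel // -lt0n.
  move=> u1 u2 v1 v2 Eu Ev cut n0.
  have su1 : in_dom g u1 by move: sut; rewrite Eu in_dom_cat => /andP[].
  have sv2 : in_dom h v2 by move: svt; rewrite Ev in_dom_cat => /andP[].
  have szu : size u1 + size u2 = i by rewrite -size_cat -Eu size_takel.
  have szv : size v1 <= j.
    have : size (take j v) <= j by rewrite size_take_min geq_minl.
    by apply: leq_trans; rewrite Ev size_cat leq_addr.
  have tu : take (size u1) u = u1.
    rewrite -(cat_take_drop i u) Eu -catA take_cat ltnn subnn take0 cats0 //.
  have tv : take (size v1) v = v1.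
    rewrite -(cat_take_drop j v) Ev -catA take_cat ltnn subnn take0 cats0 //.
  have Pu : P (size u1).
    rewrite /P lt0n size_eq0 -(ext_nil su1) n0 /=.
    rewrite (leq_trans _ iu) -?szu ?leq_addr //=.
    apply/existsP; have lt : size v1 < (size v).+1.
      by rewrite (leq_ltn_trans szv).
    by exists (Ordinal lt); rewrite /= tu tv cut.
  have u20 : u2 = [::].
    by apply/nilP; rewrite /nilp -leqn0 -(leq_add2l (size u1)) szu addn0 mini.
  split=> //; apply/eqP; rewrite -(ext_nil sv2); move: eij.
  rewrite Eu Ev u20 cats0 ext_cat cut -{1}[ext h v1]cats0 => /cat_cancel <- //.
have [||bl [hbl Eu Ev]] := IHn (drop i u) (drop j v) _ sud svd.
- by rewrite size_drop leq_subLR (leq_trans len) // -add1n leq_add2r.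
- apply: (@cat_cancel (ext g (take i u))).
  by rewrite {2}eij -!ext_cat !cat_take_drop.
exists ((take i u, take j v) :: bl); split=> /=.
- by move=> d; rewrite inE => /predU1P[->|/hbl].
- by rewrite -Eu cat_take_drop.
by rewrite -Ev cat_take_drop.
Qed.

End Words.

(** * The length of primitive solutions *)

Section Bound.
Variable A : finType.
Implicit Types (g h : {ffun A -> seq A}) (x : seq A).

(** Pads a word of length at most [n] to length [n], so that such words embed
    into a finite type of known cardinality. *)
Definition window n x : {ffun 'I_n -> option A} := [ffun i : 'I_n => onth x i].

Lemma window_inj n x y : size x <= n -> size y <= n ->
  window n x = window n y -> x = y.
Proof.
move=> sx sy /ffunP e; apply: (@eq_from_onth _ x y) => i.
have [lt|ge] := ltnP i n; first by have := e (Ordinal lt); rewrite !ffunE.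
by rewrite !onth_default // (leq_trans _ ge).
Qed.

Lemma card_window n : #|{: {ffun 'I_n -> option A}}| = #|A|.+1 ^ n.
Proof. by rewrite card_ffun card_option card_ord. Qed.

Record primitive g h x : Prop := Primitive {
  prim_neq0 : x != [::];
  prim_doml : in_dom g x;
  prim_domr : in_dom h x;
  prim_eq : ext g x = ext h x;
  prim_min : forall p q,
    x = p ++ q -> p != [::] -> ext g p = ext h p -> q = [::] }.

(** Let [p] be a proper common prefix.  It is not a solution, so one of g(p),
    h(p) is strictly longer than the other, and the excess forces the next
    letter of both words. *)
Lemma primitive_uniq g h x y : partial_marked g -> partial_marked h ->
  primitive g h x -> primitive g h y -> ohead x = ohead y -> x = y.
Proof.
move=> mg mh [x0 gx hx ex mx] [y0 gy hy ey my] Exy.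
have main x1 p y1 : p != [::] -> x = p ++ x1 -> y = p ++ y1 -> x1 = y1.
  elim: x1 p y1 => [|a x1 IHx] p y1 p0 Ex Ey.
    by rewrite cats0 in Ex; rewrite (my p y1 Ey p0) // -Ex.
  case: y1 Ey => [|b y1] Ey.
    by rewrite cats0 in Ey; apply: (mx p _ Ex p0); rewrite -Ey.
  have nE : ext g p <> ext h p by move=> /(mx _ _ Ex p0).
  suff Eab : a = b.
    rewrite Eab (IHx (rcons p a) y1) ?cat_rcons //; last by rewrite Eab.
    by rewrite -size_eq0 size_rcons.
  move: ex ey gx gy hx hy; rewrite Ex Ey !ext_cat !in_dom_cat !ext_cons /=.
  move=> ex ey /and3P[_ ga _] /and3P[_ gb _] /and3P[_ ha _] /and3P[_ hb _].
  case: (cat_eq_cat ex) => [[o Eo Et]|[o Eo Et]].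
    have o0 : o != [::] by apply/eqP=> o0; rewrite Eo o0 cats0 in nE.
    move: ey; rewrite Eo -catA => /cat_cancel Et'.
    apply: mh => //; rewrite -(ohead_cat (ext h x1) ha).
    by rewrite -(ohead_cat (ext h y1) hb) Et -Et' !ohead_cat.
  have o0 : o != [::] by apply/eqP=> o0; rewrite Eo o0 cats0 in nE.
  move: ey; rewrite Eo -catA => /cat_cancel Et'.
  apply: mg => //; rewrite -(ohead_cat (ext g x1) ga).
  by rewrite -(ohead_cat (ext g y1) gb) Et Et' !ohead_cat.
case: (x) x0 Exy main => // a x' _; case: (y) => // b y' [<-] main.
by rewrite (main x' [:: a] y').
Qed.

Lemma size_ext_le (k : A -> seq A) m x :
  (forall a, size (k a) <= m) -> size (ext k x) <= m * size x.
Proof.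
move=> km; elim: x => [|a x IHx]; first by rewrite muln0.
by rewrite ext_cons size_cat mulnS leq_add.
Qed.

Lemma size_ext_ge (k : A -> seq A) x : in_dom k x -> size x <= size (ext k x).
Proof.
elim: x => // a x IHx /= /andP[ka /IHx le]; rewrite ext_cons size_cat -add1n.
by rewrite leq_add // lt0n size_eq0.
Qed.

(** [x'] lists the first letters of the blocks of [x].  If it were as long as
    [x], every block would consist of two single letters; the first block
    would then be a one-letter solution, contradicting the primitivity of a
    word of length at least 2. *)
Lemma primitive_reduction g h x n : partial_marked g -> partial_marked h ->
  suffixes_bounded g n -> suffixes_bounded h n -> primitive g h x ->
  1 < size x ->
  exists g' h' x', [/\ partial_marked g' /\ partial_marked h',
    suffixes_bounded g' n /\ suffixes_bounded h' n, primitive g' h' x',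
    size x' < size x & size x <= n.+1 * size x'].
Proof.
move=> mg mh bg bh [x0 gx hx ex mx] x1.
have [bl [hbl Ex1 Ex2]] := block_split gx hx ex.
have [a0 _] : exists a : A, true by case: (x) x0 => // a ? _; exists a.
pose t (b : seq A * seq A) := head a0 (ext g b.1).
have ohead_t b : b \in bl -> ohead (ext g b.1) = Some (t b).
  by move=> /hbl[_ _ _]; rewrite /t; case: (ext g b.1).
pose x' := map t bl.
(* A letter that starts no block of [x] gets index [size bl], hence the default
   pair of empty words: it is outside the new domain. *)
pose blk c := nth ([::], [::]) bl (index c x').
have blkP c : c \in x' -> blk c \in bl /\ t (blk c) = c.
  move=> cx; have lt : index c x' < size bl by rewrite -(size_map t) index_mem.
  by split; rewrite ?mem_nth // -(nth_map _ a0) // nth_index.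
have blk0 c : c \notin x' -> blk c = ([::], [::]).
  by move=> cx; rewrite /blk nth_default // -(size_map t) leqNgt index_mem.
have blk_t b : b \in bl -> blk (t b) = b.
  move=> bb; have [b'b Et] := blkP (t b) (map_f t bb).
  have [] := block_head_uniq mg mh (hbl _ b'b) (hbl _ bb).
    by rewrite !ohead_t // Et.
  by move=> E1 E2; rewrite [LHS]surjective_pairing E1 E2 -surjective_pairing.
pose g' := [ffun c => (blk c).1]; pose h' := [ffun c => (blk c).2].
have g'blk c :
    (g' c != [::]) || (h' c != [::]) -> blk c \in bl /\ t (blk c) = c.
  rewrite !ffunE; have [/blkP//|/blk0->] := boolP (c \in x').
  by rewrite eqxx.
have Bg c : g' c != [::] -> exists v, block g h (g' c) v.
  move=> c0; have [|/hbl B _] := g'blk c; rewrite ?c0 //.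
  by exists (blk c).2; rewrite ffunE.
have Bh c : h' c != [::] -> exists v, block h g (h' c) v.
  move=> c0; have [|/hbl/block_sym B _] := g'blk c; rewrite ?c0 ?orbT //.
  by exists (blk c).1; rewrite ffunE.
have sub_ext (s : seq (seq A * seq A)) : {subset s <= bl} ->
    ext g' (map t s) = flatten (map fst s) /\
    ext h' (map t s) = flatten (map snd s).
  elim: s => [|b s IHs] sbl //=; have bb := sbl b (mem_head _ _).
  have [c cs|E1 E2] := IHs; first by apply: sbl; rewrite inE cs orbT.
  by rewrite !ext_cons E1 E2 !ffunE blk_t.
have [Eg' Eh'] : ext g' x' = flatten (map fst bl) /\
    ext h' x' = flatten (map snd bl) := sub_ext bl (fun _ => id).
have dom_x : in_dom g' x' /\ in_dom h' x'.
  split; apply/allP=> _ /mapP[b bb ->]; rewrite ffunE blk_t //;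
    have [gb hb eb nb _] := hbl b bb.
    by rewrite -(ext_nil gb).
  by rewrite -(ext_nil hb) -eb.
have size_x' : size x <= n.+1 * size x'.
  rewrite {1}Ex1 -Eg'; apply: size_ext_le => c.
  by apply: suffixes_bounded_size; apply: suffixes_bounded_transfer mg mh Bg bh.
have lt_x' : size x' < size x.
  rewrite ltnNge; apply/negP=> le; move: dom_x Eg' Eh' blkP le.
  case: (x') => [|c y] /=; first by rewrite leqn0 size_eq0 (negPf x0).
  case=> /andP[gc gy] /andP[hc hy]; rewrite -Ex1 -Ex2 !ext_cons => Eg Eh.
  have [cb _] := g'blk c (introT orP (or_introl gc)).
  move=> _ le; have [gb hb eb nb _] := hbl _ cb.
  have one k w :
      k != [::] -> in_dom w y -> x = k ++ ext w y -> exists a, k = [:: a].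
    move=> k0 sw Ex; move: le; rewrite Ex size_cat -add1n => le.
    have := leq_trans le (leq_add (leqnn 1) (size_ext_ge sw)).
    by rewrite leq_add2r; case: (k) k0 => // a [|//] _ _; exists a.
  have [a Ea] := one _ _ gc gy (esym Eg);
    have [b Eb] := one _ _ hc hy (esym Eh).
  move: Ea Eb Eg Eh eb; rewrite !ffunE => -> -> /= Eg; rewrite -Eg => -[-> _] e.
  by have := mx [:: a] _ (esym Eg) isT e; move: x1;
    rewrite -Eg => /[swap] /= ->.
(* The first letter of k(c) has an image starting with c, so it determines c. *)
have pm (k : {ffun A -> seq A}) (k1 k2 : A -> seq A) :
    (forall c, k c != [::] -> exists v, block k1 k2 (k c) v) ->
    (forall c, k c != [::] -> ohead (ext k1 (k c)) = Some c) ->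
    partial_marked k.
  move=> B ok c d c0 E.
  have d0 : k d != [::] by case: (k c) c0 E => //; case: (k d).
  have := ok d d0; have := ok c c0.
  have [v []] := B c c0; have [w []] := B d d0.
  case: (k c) (k d) c0 d0 E => // p ? [|q ?] //= _ _ [<-].
  move=> /andP[k0 _] _ _ _ _ _ _ _ _ _.
  by rewrite !ext_cons !ohead_cat // => -> [].
exists g', h', x'; split=> //.
- split.
    apply: (pm _ g h Bg) => c c0; have [|cb Ec] := g'blk c; rewrite ?c0 //.
    by rewrite ffunE ohead_t // Ec.
  apply: (pm _ h g Bh) => c c0; have [|cb Ec] := g'blk c; rewrite ?c0 ?orbT //.
  have [_ _ e _ _] := hbl _ cb.
  by rewrite ffunE -e ohead_t // Ec.
- split; first exact: suffixes_bounded_transfer mg mh Bg bh.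
  exact: suffixes_bounded_transfer mh mg Bh bg.
case: dom_x => g'x h'x; split=> //.
- rewrite -size_eq0 -lt0n; case: (x') size_x' x0 => //.
  by rewrite muln0 leqn0 size_eq0 => ->.
- by rewrite Eg' Eh' -Ex1.
move=> p q Epq p0 e.
have Ep : p = map t (take (size p) bl).
  by rewrite map_take -/x' Epq take_size_cat.
have s1 := @mem_take (size p) _ bl; have [E1 E2] := sub_ext _ s1.
have Ex : x = ext g' p ++ ext g' q by rewrite -ext_cat -Epq Eg'.
have P0 : ext g' p != [::].
  by move: g'x; rewrite Epq in_dom_cat => /andP[/ext_nil->].
have gq : in_dom g' q by move: g'x; rewrite Epq in_dom_cat => /andP[].
apply/eqP; rewrite -(ext_nil gq); apply/eqP/(mx _ _ Ex P0).
(* [g] and [h] agree blockwise, so a solution prefix of [x'] is mapped to a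
   solution prefix of [x]. *)
rewrite [in RHS]e Ep E1 E2; elim: (take _ _) s1 => // b s IHs sb.
have [_ _ eb _ _] := hbl b (sb b (mem_head _ _)).
by rewrite /= !ext_cat eb IHs // => c cs; apply: sb; rewrite inE cs orbT.
Qed.

(** Under a bound [n] on suffix complexity, images have length at most [n.+1];
    a pair of morphisms with the first letter of a solution is then an element
    of this finite type. *)
Notation tables n := ({ffun A -> {ffun 'I_n.+1 -> option A}} *
  {ffun A -> {ffun 'I_n.+1 -> option A}} * option A)%type.

Definition table_key n g h x : tables n :=
  ([ffun a => window n.+1 (g a)], [ffun a => window n.+1 (h a)], ohead x).

(** The base bounds the length of an image, hence the ratio between the
    lengths before and after one reduction; the exponent is the cardinality of
    [tables n] over an alphabet of size [q], hence the number of
    reductions. *)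
Definition prim_bound q n := n.+1 ^ (((q.+1 ^ n.+1) ^ q) ^ 2 * q.+1).

Lemma primitive_size n g h x : partial_marked g -> partial_marked h ->
  suffixes_bounded g n -> suffixes_bounded h n -> primitive g h x ->
  size x <= prim_bound #|A| n.
Proof.
pose good g h x := [/\ partial_marked g, partial_marked h,
  suffixes_bounded g n, suffixes_bounded h n & primitive g h x].
have key_inj g1 h1 x1 g2 h2 x2 : good g1 h1 x1 -> good g2 h2 x2 ->
    table_key n g1 h1 x1 = table_key n g2 h2 x2 -> x1 = x2.
  move=> [mg mh bg bh px] [_ _ bg2 bh2 py] [/ffunP Eg /ffunP Eh Ex].
  have Egg : g1 = g2.
    apply/ffunP => a; have := Eg a; rewrite !ffunE.
    by apply: window_inj; apply: suffixes_bounded_size.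
  have Ehh : h1 = h2.
    apply/ffunP => a; have := Eh a; rewrite !ffunE.
    by apply: window_inj; apply: suffixes_bounded_size.
  by rewrite -Egg -Ehh in py; apply: (primitive_uniq mg mh px py).
(* [V] collects the keys already met.  Their solutions are longer than the
   current one, so by [key_inj] the current key is new. *)
suff main m (V : {set tables n}) g0 h0 x0 : #|~: V| <= m -> good g0 h0 x0 ->
    (forall g1 h1 x1, good g1 h1 x1 -> table_key n g1 h1 x1 \in V ->
      size x0 < size x1) -> size x0 <= n.+1 ^ m.
  move=> mg mh bg bh px; apply: (main _ set0 g h x) => [|//|? ? ? _].
    by rewrite setC0 cardsT !card_prod !card_ffun card_option card_ord.
  by rewrite inE.
elim: m V g0 h0 x0 => [|m IHm] V g0 h0 x0 leV gd far.
  have : table_key n g0 h0 x0 \notin ~: V.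
    by move: leV; rewrite leqn0 cards_eq0 => /eqP ->; rewrite inE.
  by rewrite inE negbK => /(far _ _ _ gd); rewrite ltnn.
have keyV : table_key n g0 h0 x0 \notin V.
  by apply/negP => /(far _ _ _ gd); rewrite ltnn.
have [le1|gt1] := leqP (size x0) 1.
  by rewrite (leq_trans le1) // expn_gt0.
have [mg mh bg bh px] := gd.
have [g' [h' [x' [[mg' mh'] [bg' bh'] px' lt le]]]] :=
  primitive_reduction mg mh bg bh px gt1.
apply: leq_trans le _; rewrite expnS leq_mul2l /=.
apply: (IHm (table_key n g0 h0 x0 |: V) g' h' x') => //.
  rewrite -ltnS (leq_trans _ leV) // proper_card // properC properUr //.
  by rewrite sub1set.
move=> g1 h1 x1 gd1; rewrite in_setU1 => /predU1P[|].
  by move/(key_inj _ _ _ _ _ _ gd1 gd) ->.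
by move/(far _ _ _ gd1); apply: ltn_trans.
Qed.
End Bound.

(** * Short common solutions of several morphisms *)

Section Simultaneous.
Variables S D : finType.
Implicit Types (f : S -> seq D) (x : seq S).

Definition total_marked f := (forall a, f a != [::]) /\
  (forall a b, ohead (f a) = ohead (f b) -> a = b).

(** Reduction exchanges the roles of the source and target alphabets; over
    their disjoint union a morphism and its reductions have the same type. *)
Definition on_sum f : {ffun S + D -> seq (S + D)} :=
  [ffun a => if a is inl s then map inr (f s) else [::]].

Lemma ext_on_sum f x : ext (on_sum f) (map inl x) = map inr (ext f x).
Proof. by elim: x => //= a x IHx; rewrite !ext_cons IHx ffunE map_cat. Qed.

Lemma partial_marked_on_sum f : total_marked f -> partial_marked (on_sum f).
Proof.
move=> [f0 mf] [a|d] [b|e]; rewrite !ffunE //; last first.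
  by case: (f a) => // ? ?.
move=> _; have := mf a b;
  case: (f a) (f0 a) (f b) (f0 b) => // u r _ [|v s] //= _.
by move=> /[swap] -[->] ->.
Qed.

Lemma suffixes_bounded_on_sum f n :
  \sum_a size (f a) <= n -> suffixes_bounded (on_sum f) n.
Proof.
move=> le Y uY hY; apply: leq_trans le.
pose l := [seq [seq drop i (map inr (f a)) : seq (S + D)
                 | i <- iota 0 (size (f a))] | a <- enum S].
have -> : \sum_a size (f a) = size (flatten l).
  rewrite size_flatten /shape -map_comp sumnE big_map big_enum /=.
  by apply: eq_bigr => a _; rewrite size_map size_iota.
apply: uniq_leq_size => // y /hY[[a|d] [r]]; rewrite ffunE => -[E r0 y0];
  last by case: (r) E r0.
apply/flattenP; exists [seq drop i (map inr (f a)) | i <- iota 0 (size (f a))].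
  by apply: map_f; rewrite mem_enum.
apply/mapP; exists (size r); last by rewrite E drop_size_cat.
rewrite mem_iota /= add0n -(size_map (@inr S D)) E size_cat -{1}[size r]addn0.
by rewrite ltn_add2l lt0n size_eq0.
Qed.

(** The shortest non-empty prefix that is a solution is primitive. *)
Lemma short_factor n f1 f2 x : total_marked f1 -> total_marked f2 ->
  \sum_a size (f1 a) <= n -> \sum_a size (f2 a) <= n ->
  x != [::] -> ext f1 x = ext f2 x ->
  exists p q, [/\ x = p ++ q, p != [::], ext f1 p = ext f2 p &
    size p <= prim_bound (#|S| + #|D|) n].
Proof.
move=> m1 m2 b1 b2 x0 e.
pose P i := (0 < i <= size x) && (ext f1 (take i x) == ext f2 (take i x)).
have exP : exists i, P i.
  by exists (size x); rewrite /P take_size e eqxx lt0n size_eq0 x0 leqnn.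
case: (ex_minnP exP) => i /andP[/andP[i0 ix] /eqP ei] mini.
exists (take i x), (drop i x); rewrite cat_take_drop; split=> //.
  by rewrite -size_eq0 size_takel // -lt0n.
rewrite -card_sum -(size_map (@inl S D)).
apply: (@primitive_size _ n (on_sum f1) (on_sum f2));
  try exact: partial_marked_on_sum; try exact: suffixes_bounded_on_sum.
have sp f y : total_marked f -> in_dom (on_sum f) (map inl y).
  move=> [f0 _]; apply/allP=> _ /mapP[a _ ->].
  by rewrite ffunE -size_eq0 size_map size_eq0.
split; rewrite ?sp ?ext_on_sum ?ei //.
  by rewrite -size_eq0 size_map size_takel // -lt0n.
move=> p q Epq p0.
pose u := take (size p) (take i x).
have Ep : p = map inl u by rewrite map_take Epq take_size_cat.
have su : size u = size p by rewrite Ep size_map.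
have Pi : size p + size q = i by rewrite -size_cat -Epq size_map size_takel.
have le : size p <= i by rewrite -Pi leq_addr.
have inr_inj : injective (@inr S D) by move=> ? ? [].
rewrite Ep !ext_on_sum => /(inj_map inr_inj) eu.
have : i <= size p.
  apply: mini; rewrite /P lt0n size_eq0 p0 (leq_trans le ix) /=.
  by move: eu; rewrite /u take_takel // => ->.
by rewrite -Pi -{2}[size p]addn0 leq_add2l leqn0 size_eq0 => /eqP.
Qed.

Definition solution_bound q n k := (q.+1 ^ prim_bound q n) ^ k.

(** Pumping: the words [r j i] below tell which continuations of the prefix of
    length [i] make [f0] and [F j] agree, and there are boundedly many of
    them. *)
Lemma short_solution k n f0 (F : 'I_k -> S -> seq D) x :
  total_marked f0 -> (forall j, total_marked (F j)) ->
  \sum_a size (f0 a) <= n -> (forall j, \sum_a size (F j a) <= n) ->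
  x != [::] -> (forall j, ext f0 x = ext (F j) x) ->
  exists y, [/\ y != [::], forall j, ext f0 y = ext (F j) y &
    size y <= (#|S|.+1 ^ prim_bound (#|S| + #|D|) n) ^ k].
Proof.
move=> m0 mF b0 bF; set N := prim_bound _ _.
move: {2}(size x) (leqnn (size x)) => m.
elim: m x => [|m IHm] x lex x0 e; first by case: x lex x0 {e}.
have [le|gt] := leqP (size x) ((#|S|.+1 ^ N) ^ k); first by exists x.
pose cut j (i : nat) (c : 'I_i.+1) := ext f0 (take c x) == ext (F j) (take c x).
(* The longest prefix of [take i x] on which [f0] and [F j] agree. *)
pose c j i := [arg max_(c > ord0 | @cut j i c) (c : nat)].
have cP j i : ext f0 (take (c j i) x) = ext (F j) (take (c j i) x) /\
   (forall d, d <= i -> ext f0 (take d x) = ext (F j) (take d x) -> d <= c j i).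
  rewrite /c; case: arg_maxnP => [|d /eqP cd maxd]; first by rewrite /cut take0.
  split=> // d' le' e'; have := maxd (Ordinal (le' : d' < i.+1)); apply.
  exact/eqP.
pose r j i := drop (c j i) (take i x).
have rP j i : take i x = take (c j i) x ++ r j i.
  by rewrite -[LHS](cat_take_drop (c j i)) take_takel // -ltnS.
have rN j i : i <= size x -> size (r j i) <= N.
  move=> ix; have [ec maxc] := cP j i.
  have ed : ext f0 (drop (c j i) x) = ext (F j) (drop (c j i) x).
    by apply: (@cat_cancel _ (ext f0 (take (c j i) x)));
      rewrite {2}ec -!ext_cat cat_take_drop.
  have [d0|dN] := eqVneq (drop (c j i) x) [::].
    have : size (drop (c j i) x) = 0 by rewrite d0.
    rewrite size_drop size_drop size_takel // => /eqP; rewrite subn_eq0 => le.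
    by rewrite (_ : i - c j i = 0) //; apply/eqP;
      rewrite subn_eq0 (leq_trans ix).
  have [p [q [Epq p0 ep sp]]] := short_factor m0 (mF j) b0 (bF j) dN ed.
  rewrite leqNgt; apply/negP=> ltN.
  have ltp : size p < size (r j i) := leq_ltn_trans sp ltN.
  have le_i : c j i + size p <= i.
    by move: ltp; rewrite size_drop size_takel // ltn_subRL; exact: ltnW.
  have : c j i + size p <= c j i.
    by apply: maxc => //; rewrite takeD Epq take_size_cat // !ext_cat ec ep.
  by rewrite -[leqRHS]addn0 leq_add2l leqn0 size_eq0 (negPf p0).
(* Prefixes of length [i.+1] only: the shortened word must stay non-empty. *)
pose key (i : 'I_(size x)) := [ffun j => window N (r j i.+1)].
have /injectivePn[i [i' ne Ekey]] : ~~ injectiveb key.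
  apply/negP=> /injectiveP/leq_card.
  by rewrite card_ord card_ffun card_window card_ord leqNgt gt.
wlog lt : i i' ne Ekey / i < i'.
  move=> wl; have [||E] := ltngtP i i'; first exact: wl.
    by apply: wl; rewrite // eq_sym.
  by rewrite (ord_inj E) eqxx in ne.
apply: (IHm (take i.+1 x ++ drop i'.+1 x)).
- rewrite -ltnS (leq_trans _ lex) // size_cat size_drop size_takel //.
  by rewrite -[ltnRHS](subnKC (ltn_ord i')) ltn_add2r ltnS.
- by rewrite -size_eq0 size_cat size_takel.
move=> j; have Er : r j i.+1 = r j i'.+1.
  by move/ffunP/(_ j): Ekey; rewrite !ffunE; apply: window_inj; apply: rN.
rewrite (rP j i.+1) Er -catA [LHS]ext_cat [RHS]ext_cat (proj1 (cP _ _));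
  congr (_ ++ _).
apply: (@cat_cancel _ (ext f0 (take (c j i'.+1) x))).
by rewrite {2}(proj1 (cP _ _)) -!ext_cat catA -rP // cat_take_drop.
Qed.
End Simultaneous.

(** * Closure properties of recursive functions *)

(** The arguments form an untyped list, whatever the arity [n]: closure lemmas
    can then pass from a context to a longer one without casts between tuple
    types. *)
Definition recursive n (f : seq nat -> nat) : Prop :=
  exists p : murec n, forall v : n.-tuple nat, murec_eval p v (f v).

Lemma recursive_ext n f g : (forall v, size v = n -> f v = g v) ->
  recursive n g -> recursive n f.
Proof. by move=> e [p hp]; exists p => v; rewrite e ?size_tuple. Qed.

Lemma recursive_proj n i : i < n -> recursive n (fun v => nth 0 v i).
Proof.
move=> lt; exists (MProj (Ordinal lt)) => v.
by rewrite -[nth _ _ _]/(nth 0 v (Ordinal lt)) -tnth_nth; constructor.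
Qed.

Lemma recursive_comp m n f (gs : m.-tuple (seq nat -> nat)) :
  recursive m f -> (forall i, recursive n (tnth gs i)) ->
  recursive n (fun v => f [seq g v | g <- gs]).
Proof.
move=> [p hp] /fin_all_exists[q hq]; exists (MComp p q) => v.
apply: (@eval_comp m n p q v (map_tuple (fun g => g (val v)) gs)) => [i|];
  last exact: hp.
by rewrite tnth_map; apply: hq.
Qed.

Notation recursive1 f := (recursive 1 (fun v => f (nth 0 v 0))).
Notation recursive2 f := (recursive 2 (fun v => f (nth 0 v 0) (nth 0 v 1))).

Lemma recursive_comp1 n f a : recursive1 f -> recursive n a ->
  recursive n (fun v => f (a v)).
Proof.
move=> rf ra; apply: (recursive_comp (gs := [tuple a]) rf) => i.
by rewrite (ord1 i).
Qed.

Lemma recursive_comp2 n f a b :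
  recursive2 f -> recursive n a -> recursive n b ->
  recursive n (fun v => f (a v) (b v)).
Proof.
move=> rf ra rb; apply: (recursive_comp (gs := [tuple a; b]) rf).
by case=> -[|[|]].
Qed.

Lemma recursive_succ : recursive1 S.
Proof.
by exists MSucc => v; case/tupleP: v => x v; rewrite (tuple0 v);
  apply: eval_succ.
Qed.

Lemma recursive_const n c : recursive n (fun=> c).
Proof.
elim: c => [|c IHc]; first by exists (MZero n) => v; constructor.
exact: (recursive_comp1 recursive_succ).
Qed.

(** Primitive recursion on the first argument, with the others as
    parameters. *)
Lemma recursive_primrec n f g : recursive n f -> recursive n.+2 g ->
  recursive n.+1 (fun w =>
    nat_rect (fun=> nat) (f (behead w)) (fun i z => g [:: i, z & behead w])
      (nth 0 w 0)).
Proof.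
move=> [p hp] [q hq]; exists (MRec p q) => w; case/tupleP: w => x v /=.
have E y : [tuple of y :: v] = cons_tuple y v by apply: val_inj.
rewrite E; elim: x => [|x IHx] /=; first exact: eval_rec0.
by apply: eval_recS IHx _; apply: (hq (cons_tuple _ (cons_tuple _ v))).
Qed.

(** A loop inside an arbitrary context: [i] is the counter, [z] the
    accumulator and [v] the surrounding context. *)
Lemma recursive_loop n a f g : recursive n a -> recursive n f ->
  recursive n.+2 (fun w => g (nth 0 w 0) (nth 0 w 1) (behead (behead w))) ->
  recursive n (fun v => nat_rect (fun=> nat) (f v) (fun i z => g i z v) (a v)).
Proof.
move=> ra rf rg.
pose proj i : seq nat -> nat := fun v => nth 0 v i.
have sz : size (a :: [seq proj i | i <- iota 0 n]) == n.+1.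
  by rewrite /= size_map size_iota.
have := recursive_comp (gs := Tuple sz) (recursive_primrec rf rg) (n := n).
move=> /= H; apply: recursive_ext (H _); last first.
  move=> i; rewrite (tnth_nth (proj 0)) /=; case: i => -[|i] //= lt.
  rewrite (nth_map 0) ?size_iota // nth_iota // add0n; exact: recursive_proj.
move=> v sv; have -> // : [seq g0 v | g0 <- [seq proj i | i <- iota 0 n]] = v.
by rewrite -map_comp -sv; exact: mkseq_nth.
Qed.

Lemma recursive_proj1 n i : i.+1 < n ->
  recursive n (fun v => nth 0 (behead v) i).
Proof.
move=> lt; apply: recursive_ext (recursive_proj lt) => v _.
by rewrite nth_behead.
Qed.

Lemma recursive_proj2 n i : i.+2 < n ->
  recursive n (fun v => nth 0 (behead (behead v)) i).
Proof.
move=> lt; apply: recursive_ext (recursive_proj lt) => v _.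
by rewrite !nth_behead.
Qed.

Lemma recursive_S n a : recursive n a -> recursive n (fun v => (a v).+1).
Proof. exact: (recursive_comp1 recursive_succ). Qed.

(** A hook for [recur], redefined as more operations are shown to preserve
    recursiveness. *)
Ltac recursive_closure := fail.

Ltac recur := repeat first
  [ apply: recursive_const | by apply: recursive_proj
  | by apply: recursive_proj1 | by apply: recursive_proj2
  | apply: recursive_S | recursive_closure ].

Lemma recursive_add n a b : recursive n a -> recursive n b ->
  recursive n (fun v => a v + b v).
Proof.
apply: recursive_comp2.
apply: recursive_ext (recursive_loop (a := fun v => nth 0 v 0)
  (f := fun v => nth 0 v 1) (g := fun i z v => z.+1) _ _ _); recur.
by move=> v _; elim: (nth 0 v 0) => //= x IHx; rewrite addSn IHx.
Qed.

Lemma recursive_mul n a b : recursive n a -> recursive n b ->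
  recursive n (fun v => a v * b v).
Proof.
apply: recursive_comp2.
apply: recursive_ext (recursive_loop (a := fun v => nth 0 v 0) (f := fun v => 0)
  (g := fun i z v => nth 0 v 1 + z) _ _ _); recur;
  last by apply: recursive_add; recur.
by move=> v _; elim: (nth 0 v 0) => //= x IHx; rewrite mulSn IHx.
Qed.

Lemma recursive_exp n a b : recursive n a -> recursive n b ->
  recursive n (fun v => a v ^ b v).
Proof.
apply: recursive_comp2.
apply: recursive_ext (recursive_loop (a := fun v => nth 0 v 1) (f := fun v => 1)
  (g := fun i z v => nth 0 v 0 * z) _ _ _); recur;
    last by apply: recursive_mul; recur.
by move=> v _; elim: (nth 0 v 1) => //= x IHx; rewrite expnS IHx.
Qed.

Lemma recursive_pred n a : recursive n a -> recursive n (fun v => (a v).-1).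
Proof.
apply: recursive_comp1.
apply: recursive_ext (recursive_loop (a := fun v => nth 0 v 0) (f := fun v => 0)
  (g := fun i z v => i) _ _ _); recur.
by move=> v _; case: (nth 0 v 0).
Qed.

Lemma recursive_sub n a b : recursive n a -> recursive n b ->
  recursive n (fun v => a v - b v).
Proof.
apply: (@recursive_comp2 _ subn).
apply: recursive_ext (recursive_loop (a := fun v => nth 0 v 1)
  (f := fun v => nth 0 v 0) (g := fun i z v => z.-1) _ _ _); recur;
  last by apply: recursive_pred; recur.
by move=> v _; elim: (nth 0 v 1) => [|x IHx] /=; rewrite ?subn0 // subnS IHx.
Qed.

Lemma recursive_leq n a b : recursive n a -> recursive n b ->
  recursive n (fun v => a v <= b v).
Proof.
move=> ra rb.
apply: recursive_ext (recursive_sub (recursive_const n 1)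
  (recursive_sub ra rb)).
by move=> v _; rewrite /leq; case: (_ - _).
Qed.

Lemma recursive_eq n a b : recursive n a -> recursive n b ->
  recursive n (fun v => a v == b v).
Proof.
move=> ra rb.
apply: recursive_ext (recursive_mul (recursive_leq ra rb)
  (recursive_leq rb ra)).
by move=> v _; rewrite eqn_leq mulnb.
Qed.

Lemma recursive_neg n (a : seq nat -> bool) :
  recursive n a -> recursive n (fun v => ~~ a v).
Proof.
move=> ra; apply: recursive_ext (recursive_sub (recursive_const n 1) ra).
by move=> v _; case: (a v).
Qed.

(** Bounded sums of truth values express bounded quantifiers, and bounded sums
    with a single non-zero term express bounded description. *)
Lemma recursive_sum n a F : recursive n a ->
  recursive n.+1 (fun w => F (nth 0 w 0) (behead w)) ->
  recursive n (fun v => \sum_(i < a v) F i v).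
Proof.
move=> ra rF.
have rg : recursive n.+2
    (fun w => nth 0 w 1 + F (nth 0 w 0) (behead (behead w))).
  apply: recursive_add; first exact: recursive_proj.
  pose proj i : seq nat -> nat := fun v => nth 0 v i.
  have sz : size [seq proj i | i <- 0 :: iota 2 n] == n.+1.
    by rewrite /= size_map size_iota.
  apply: recursive_ext (recursive_comp (gs := Tuple sz) rF _).
    move=> [|x [|y v]] //= [sv]; congr F; rewrite -map_comp -sv.
    by rewrite -[LHS](mkseq_nth 0) /mkseq -[2]addn0 iotaDl -map_comp.
  move=> i; rewrite (tnth_nth (proj 0)) (nth_map 0); last first.
    by have := ltn_ord i; rewrite /= size_iota.
  apply: recursive_proj; case: i => -[|i] //= lt.
  by rewrite nth_iota // add2n !ltnS.
apply: recursive_ext (recursive_loop (f := fun=> 0)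
  (g := fun i z v => z + F i v) ra (recursive_const n 0) rg).
move=> v _; elim: (a v) => [|m IHm]; first by rewrite big_ord0.
by rewrite big_ord_recr IHm.
Qed.

Ltac recursive_closure ::= first
  [ apply: recursive_add | apply: recursive_sub | apply: recursive_mul
  | apply: recursive_exp | apply: recursive_leq | apply: recursive_eq
  | apply: recursive_neg ].

(** * Words as numbers *)

Notation code := CodeSeq.code.
Notation decode := CodeSeq.decode.

Lemma code_cons a s : code (a :: s) = 2 ^ a * (code s * 2).+1.
Proof. by rewrite /= muln2. Qed.

Lemma code_inj : injective code.
Proof. exact: can_inj CodeSeq.codeK. Qed.

Lemma sum_succ_le_code s : \sum_(a <- s) a.+1 <= code s.
Proof.
elim: s => [|a s IHs]; first by rewrite big_nil.
rewrite big_cons code_cons (leq_trans (leq_add (ltn_expl a (leqnn 2)) IHs)) //.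
rewrite mulnS leq_add2l muln2 -addnn mulnDr -[leqLHS]add0n leq_add //.
by rewrite leq_pmull // expn_gt0.
Qed.

Lemma code_ltn c s : all (fun a => a < c) s -> code s < 2 ^ (c * size s).
Proof.
elim: s => [|a s IHs]; first by rewrite muln0.
case/andP=> ac /IHs lt; rewrite code_cons /= [c * _]mulnS expnD.
apply: (@leq_trans (2 ^ a.+1 * 2 ^ (c * size s))).
  rewrite expnSr -mulnA ltn_pmul2l ?expn_gt0 // mul2n -muln2.
  by apply: (@leq_trans ((code s).+1 * 2)); rewrite ?leq_mul2r // mulSn.
by rewrite leq_pmul2r ?expn_gt0 // leq_exp2l.
Qed.

(** The head and the tail of a coded sequence are recovered by searching for
    the unique pair with 2 ^ h * (2 t + 1) = m. *)
Lemma sum_code (F : nat -> nat -> nat) m :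
  \sum_(t < m) \sum_(h < m) F h t * (2 ^ h * (t * 2).+1 == m) =
  if decode m is h :: s then F h (code s) else 0.
Proof.
rewrite -[m in LHS]CodeSeq.decodeK; case: (decode m) => [|h s].
  by rewrite big_ord0.
set M := code (h :: s).
have hM : h < M.
  by rewrite /M code_cons (leq_trans (ltn_expl h (leqnn 2))) // leq_pmulr.
have sM : code s < M.
  rewrite /M code_cons (leq_trans _ (leq_pmull _ _)) ?expn_gt0 //.
  by rewrite ltnS muln2 -addnn leq_addr.
have E t k : (2 ^ k * (t * 2).+1 == M) = (k == h) && (t == code s).
  apply/eqP/andP => [|[/eqP-> /eqP->]]; last by rewrite /M code_cons.
  by rewrite -[t]CodeSeq.decodeK -code_cons => /code_inj[-> ->].
rewrite (bigD1 (Ordinal sM)) //= [X in _ + X]big1 => [|t ne].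
  rewrite (bigD1 (Ordinal hM)) //= [X in _ + X + _]big1 => [|k ne].
    by rewrite E !eqxx muln1 !addn0.
  by rewrite E; move: ne; rewrite -val_eqE /= => /negPf->; rewrite muln0.
apply: big1 => k _.
by rewrite E; move: ne; rewrite -val_eqE /= => /negPf->; rewrite andbF muln0.
Qed.

Lemma recursive_head n a : recursive n a ->
  recursive n (fun v => head 0 (decode (a v))).
Proof.
apply: (recursive_comp1 (f := fun m => head 0 (decode m))).
apply: (recursive_ext (g := fun v => \sum_(t < nth 0 v 0) \sum_(h < nth 0 v 0)
    h * (2 ^ h * (t * 2).+1 == nth 0 v 0))).
  by move=> v _; rewrite (sum_code (fun h t => h)); case: (decode _).
apply: (recursive_sum (F := fun t v => \sum_(h < nth 0 v 0)
    h * (2 ^ h * (t * 2).+1 == nth 0 v 0))); recur.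
apply: (recursive_sum (F := fun h w =>
  h * (2 ^ h * (nth 0 w 0 * 2).+1 == nth 0 (behead w) 0))); recur.
Qed.

Lemma recursive_tail n a : recursive n a ->
  recursive n (fun v => code (behead (decode (a v)))).
Proof.
apply: (recursive_comp1 (f := fun m => code (behead (decode m)))).
apply: (recursive_ext (g := fun v => \sum_(t < nth 0 v 0) \sum_(h < nth 0 v 0)
    t * (2 ^ h * (t * 2).+1 == nth 0 v 0))).
  by move=> v _; rewrite (sum_code (fun h t => t)); case: (decode _).
apply: (recursive_sum (F := fun t v => \sum_(h < nth 0 v 0)
    t * (2 ^ h * (t * 2).+1 == nth 0 v 0))); recur.
apply: (recursive_sum (F := fun h w =>
  nth 0 w 0 * (2 ^ h * (nth 0 w 0 * 2).+1 == nth 0 (behead w) 0))); recur.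
Qed.

Lemma recursive_drop n a b : recursive n a -> recursive n b ->
  recursive n (fun v => code (drop (a v) (decode (b v)))).
Proof.
apply: (recursive_comp2 (f := fun i m => code (drop i (decode m)))).
apply: recursive_ext (recursive_loop (a := fun v => nth 0 v 0)
  (f := fun v => nth 0 v 1) (g := fun i z v => code (behead (decode z)))
  _ _ _); recur; last by apply: recursive_tail; recur.
move=> v _; elim: (nth 0 v 0) => [|i IHi] /=.
  by rewrite drop0 CodeSeq.decodeK.
by rewrite -IHi CodeSeq.codeK -drop1 drop_drop add1n.
Qed.

Definition item m i := nth 0 (decode m) i.

Lemma recursive_item n a b : recursive n a -> recursive n b ->
  recursive n (fun v => item (a v) (b v)).
Proof.
move=> ra rb.
apply: recursive_ext (recursive_head (recursive_drop rb ra)) => v _.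
by rewrite CodeSeq.codeK /item -nth0 nth_drop addn0.
Qed.

Definition len m := size (decode m).

Lemma len_le_code s : size s <= code s.
Proof.
apply: leq_trans (sum_succ_le_code s).
by elim: s => [|a s IHs];
  rewrite ?big_nil // big_cons (leq_trans (n := 1 + size s)) // leq_add.
Qed.

Lemma recursive_len n a : recursive n a -> recursive n (fun v => len (a v)).
Proof.
apply: recursive_comp1.
apply: recursive_ext (recursive_sum (a := fun v => nth 0 v 0)
  (F := fun i v => ~~ (code (drop i (decode (nth 0 v 0))) == 0)) _ _);
  recur; last by apply: recursive_drop; recur.
move=> v _; set m := nth 0 v 0.
have E (i : nat) : (code (drop i (decode m)) == 0) = (len m <= i).
  by rewrite -[0]/(code [::]) (inj_eq code_inj) -size_eq0 size_drop subn_eq0.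
under eq_bigr do rewrite E -ltnNge.
have le : len m <= m by rewrite -[leqRHS]CodeSeq.decodeK; apply: len_le_code.
rewrite [LHS](_ : _ = \sum_(i < len m) 1);
  last by rewrite sum_nat_const card_ord muln1.
rewrite (big_ord_widen m (fun=> 1) le) big_mkcond /=.
by apply: eq_bigr => i _; case: (_ < _).
Qed.

Ltac recursive_closure ::= first
  [ apply: recursive_add | apply: recursive_sub | apply: recursive_mul
  | apply: recursive_exp | apply: recursive_leq | apply: recursive_eq
  | apply: recursive_neg | apply: recursive_len | apply: recursive_item ].

Lemma recursive_catrev n a b : recursive n a -> recursive n b ->
  recursive n (fun v => code (catrev (decode (a v)) (decode (b v)))).
Proof.
apply: (recursive_comp2 (f := fun x y => code (catrev (decode x) (decode y)))).
apply: recursive_ext (recursive_loop (a := fun v => len (nth 0 v 0))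
  (f := fun v => nth 0 v 1)
  (g := fun i z v => 2 ^ (item (nth 0 v 0) i) * (z * 2).+1) _ _ _); recur.
move=> v _; set w := decode _; set y := nth 0 v 1.
rewrite -{1}(take_size w) /len -/w.
elim: {-2}(size w) (leqnn (size w)) => [|i IHi] le;
  first by rewrite take0 CodeSeq.decodeK.
rewrite (take_nth 0) // -cats1 catrev_catl /= -IHi ?(ltnW le) //.
by rewrite -code_cons.
Qed.

(** The image is produced in reverse, because pushing letters one at a time in
    front of an accumulator only needs the code of [::]; reversal is
    injective, so comparing reversed images suffices. *)
Definition image f x :=
  code (rev (flatten [seq decode (item f a) | a <- decode x])).

Lemma recursive_image n a b : recursive n a -> recursive n b ->
  recursive n (fun v => image (a v) (b v)).
Proof.
apply: recursive_comp2.
apply: recursive_ext (recursive_loop (a := fun v => len (nth 0 v 1))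
  (f := fun=> 0) (g := fun i z v =>
    code (catrev (decode (item (nth 0 v 0) (item (nth 0 v 1) i))) (decode z)))
  _ _ _); recur; last by apply: recursive_catrev; recur.
move=> v _; rewrite /image; set f := nth 0 v 0; set x := nth 0 v 1.
rewrite -{1}(take_size (decode x)) /len.
elim: {-2}(size _) (leqnn (size (decode x))) => [|i IHi] le;
  first by rewrite take0.
rewrite (take_nth 0) // map_rcons -cats1 flatten_cat /= cats0 rev_cat.
by rewrite -IHi ?(ltnW le) // CodeSeq.codeK catrevE.
Qed.

(** * The decision procedure *)

Definition disagrees c j x : bool :=
  ~~ (image (item (item c 2) j) x == image (item (item c 2) 0) x).

(** The code of the empty word is 0.  In an instance [c], item 0 is the size of
    the source alphabet and item 2 the list of morphisms; comparing each of
    them with the first one is enough. *)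
Definition test c x : bool :=
  (0 < x) && ((\sum_(i < len x) (item c 0 <= item x i) == 0) &&
  (\sum_(j < len (item c 2)) disagrees c j x == 0)).

(** Every parameter of the instance is at most its code. *)
Definition word_bound c := solution_bound c c c.

Definition verdict c : bool := \sum_(x < 2 ^ (c * word_bound c)) test c x == 0.

Lemma recursive_verdict : recursive1 verdict.
Proof.
apply: recursive_eq; recur.
apply: (recursive_sum (F := fun x v => test (nth 0 v 0) x)).
  by rewrite /word_bound /solution_bound /prim_bound; recur.
apply: (@recursive_ext _ _ (fun w => (0 < nth 0 w 0) *
  ((\sum_(i < len (nth 0 w 0)) (item (nth 0 w 1) 0 <= item (nth 0 w 0) i)
    == 0) *
   (\sum_(j < len (item (nth 0 w 1) 2)) disagrees (nth 0 w 1) j (nth 0 w 0)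
    == 0)))).
  by move=> w _; rewrite nth_behead /test !mulnb.
recur.
  apply: (recursive_sum (F := fun i w =>
    item (nth 0 w 1) 0 <= item (nth 0 w 0) i)); by recur.
apply: (recursive_sum (F := fun j w => disagrees (nth 0 w 1) j (nth 0 w 0)));
  first by recur.
by rewrite /disagrees; recur; apply: recursive_image; recur.
Qed.

Section Encoding.
Variables S D : finType.
Implicit Types (f g : morphism S D) (x : free_monoid S).

Definition letter_image f a : seq D := f (gen a).

Lemma morphism_ext f x : f x = ext (letter_image f) x.
Proof.
elim: x => [|a x IHx]; first exact: gmulf1.
rewrite ext_cons -IHx; exact: (@gmulfM _ _ f (gen a) x).
Qed.

Lemma decode_word (T : finType) (w : free_monoid T) :
  decode (encode_word w) = [seq nat_of_ord (enum_rank a) | a <- w].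
Proof. exact: CodeSeq.codeK. Qed.

Lemma encode_word_inj (T : finType) : injective (@encode_word T).
Proof. by move=> x y /code_inj/inj_map; apply=> a b /ord_inj/enum_rank_inj. Qed.

Lemma item_morphism f a :
  item (encode_morphism f) (enum_rank a) = encode_word (letter_image f a).
Proof.
rewrite /item /encode_morphism CodeSeq.codeK (nth_map a) ?nth_enum_rank //.
by rewrite -cardE.
Qed.

Lemma image_encode f x :
  image (encode_morphism f) (encode_word x) = encode_word (rev (f x)).
Proof.
rewrite /image decode_word morphism_ext -map_comp /encode_word map_rev.
congr (code (rev _)).
rewrite /ext map_flatten -map_comp; congr flatten; apply: eq_map => a /=.
by rewrite item_morphism decode_word.
Qed.

Variable fs : seq (morphism S D).
Local Notation c := (encode_instance fs).

Lemma item_instance : (item c 0 = #|S|) *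
  (item c 2 = code [seq encode_morphism f | f <- fs]).
Proof. by rewrite /item /encode_instance CodeSeq.codeK. Qed.

Lemma item_instance_nth f0 j : j < size fs ->
  item (item c 2) j = encode_morphism (nth f0 fs j).
Proof.
by move=> lt; rewrite item_instance /item CodeSeq.codeK (nth_map f0).
Qed.

Lemma len_instance : len (item c 2) = size fs.
Proof. by rewrite item_instance /len CodeSeq.codeK size_map. Qed.

End Encoding.

Lemma In_nth T (x0 : T) s x :
  List.In x s -> exists2 j, j < size s & nth x0 s j = x.
Proof.
elim: s => //= y s IHs [->|/IHs[j lt <-]]; first by exists 0.
by exists j.+1.
Qed.

Lemma nth_In T (x0 : T) s j : j < size s -> List.In (nth x0 s j) s.
Proof. by elim: s j => //= y s IHs [|j] lt; [left|right; apply: IHs]. Qed.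

Section Test.
Variables S D : finType.
Variable fs : seq (morphism S D).
Local Notation c := (encode_instance fs).

Lemma EqS_nth f0 (x : free_monoid S) : 0 < size fs ->
  (EqS fs x <-> forall j, j < size fs -> nth f0 fs j x = nth f0 fs 0 x).
Proof.
move=> fs0; split=> [E j lt|E g h gS hS]; first by apply: E; apply: nth_In.
by have [[i li <-] [j lj <-]] := (In_nth f0 gS, In_nth f0 hS); rewrite /Eq !E.
Qed.

Lemma test_word (x : free_monoid S) :
  test c (encode_word x) <-> x <> [::] /\ EqS fs x.
Proof.
rewrite /test /len decode_word size_map -/(len _) len_instance.
have -> : 0 < encode_word x = (x != [::]).
  rewrite lt0n; case: x => // a x.
  by rewrite /encode_word map_cons code_cons muln_eq0 expn_eq0.
rewrite item_instance [X in X == 0]big1 => [|i _]; last first.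
  have [a _] : exists a : S, true by case: x i => [[]|a] // *; exists a.
  by rewrite /item decode_word (nth_map a) // leqNgt ltn_ord.
set same := (X in [&& _, _ & X]).
suff E : same <-> EqS fs x.
  by rewrite -E /=; split=> [/andP[/eqP]|[/eqP-> ->]].
have [/size0nil fs0|fs0] := posnP (size fs).
  by rewrite /same fs0 big_ord0; split=> // _ g h [].
have [f0 _] : exists f : morphism S D, true.
  by case: (fs) fs0 => // f ? _; exists f.
rewrite (EqS_nth f0 _ fs0) /same /disagrees sum_nat_eq0.
split=> [/forallP all_eq j lt|all_eq].
  have := all_eq (Ordinal lt).
  rewrite /= !(item_instance_nth f0) // !image_encode.
  by rewrite eqb0 negbK => /eqP/encode_word_inj/(can_inj revK).
apply/forallP=> j; rewrite !(item_instance_nth f0) // !image_encode eqb0 negbK.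
by rewrite (all_eq j (ltn_ord j)) eqxx.
Qed.

Lemma test_decode m : test c m -> exists x : free_monoid S, m = encode_word x.
Proof.
case/and3P=> _; rewrite item_instance => z _.
suff [x Ex] : exists x : seq S,
    decode m = [seq nat_of_ord (enum_rank a) | a <- x].
  by exists x; rewrite -[LHS]CodeSeq.decodeK Ex.
have : all (fun a => a < #|S|) (decode m).
  apply/(all_nthP 0) => i lt; move: z.
  rewrite sum_nat_eq0 => /forallP/(_ (Ordinal lt)) /=.
  by rewrite ltnNge; case: (_ <= _).
elim: (decode m) => [|a s IHs]; first by exists [::].
move=> /= /andP[la /IHs[x ->]]; exists (enum_val (Ordinal la) :: x) => /=.
by rewrite enum_valK.
Qed.

End Test.

Lemma leq_pow a b c d : 0 < b -> a <= b -> c <= d -> a ^ c <= b ^ d.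
Proof.
move=> b0 ab cd; apply: leq_trans (leq_pexp2l b0 cd).
by case: c {cd} => // c; rewrite leq_exp2r.
Qed.

Lemma solution_bound_mono q q' n n' k k' : q <= q' -> n <= n' -> k <= k' ->
  solution_bound q n k <= solution_bound q' n' k'.
Proof.
move=> qq nn kk; rewrite /solution_bound /prim_bound.
by repeat first [apply: leq_pow | apply: leq_mul | rewrite expn_gt0 | done].
Qed.

Section Bounded.
Variables S D : finType.
Variable fs : seq (morphism S D).
Hypothesis marked_fs : forall f, List.In f fs -> marked f.
Local Notation c := (encode_instance fs).

Lemma code_fs_le : code [seq encode_morphism f | f <- fs] <= c.
Proof.
apply: leq_trans (sum_succ_le_code _).
by rewrite !big_cons big_nil addn0 addnA (leq_trans (leqnSn _)) // leq_addl.
Qed.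

Lemma sizes_le_instance : #|S| + #|D| <= c /\ size fs <= c.
Proof.
have := sum_succ_le_code [:: #|S|; #|D|;
  code [seq encode_morphism f | f <- fs]].
rewrite !big_cons big_nil addn0 -/c => le.
have := len_le_code [seq encode_morphism f | f <- fs]; rewrite size_map => le'.
split; last exact: leq_trans le' code_fs_le.
by apply: leq_trans le; rewrite leq_add // (leq_trans (leqnSn _)) // leq_addr.
Qed.

Lemma sum_letters_le f : List.In f fs -> \sum_a size (letter_image f a) <= c.
Proof.
move=> fin; apply: (@leq_trans (encode_morphism f)).
  apply: leq_trans (sum_succ_le_code _); rewrite big_map big_enum /=.
  apply: leq_sum => a _; apply: leqW;
    rewrite -(size_map (fun a => nat_of_ord (enum_rank a))).
  exact: len_le_code.
have [j lt <-] := In_nth f fin; apply: leq_trans code_fs_le.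
apply: leq_trans (sum_succ_le_code _); rewrite big_map (big_nth f) big_mkord.
by rewrite (bigD1 (Ordinal lt)) //= (leq_trans (leqnSn _)) // leq_addr.
Qed.

Lemma total_marked_morphism f : marked f -> @total_marked S D (letter_image f).
Proof.
case=> f0 fm; split=> [a|a b E]; first by apply/eqP/f0.
by apply/eqP/negPn/negP=> /eqP/fm; apply.
Qed.

(** The case of no morphism is apart, as there is no [f0] to compare with:
    any letter is then a solution. *)
Lemma small_solution x : x <> [::] -> EqS fs x ->
  exists y, [/\ y <> [::], EqS fs y & encode_word y < 2 ^ (c * word_bound c)].
Proof.
move=> x0 ex; have [le_q le_k] := sizes_le_instance.
suff [y [y0 ey le]] :
    exists y, [/\ y <> [::], EqS fs y & size y <= word_bound c].
  exists y; split=> //; apply: leq_trans (code_ltn (c := c) _) _.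
    apply/allP=> _ /mapP[a _ ->]; rewrite (leq_trans (ltn_ord _)) //.
    exact: leq_trans (leq_addr _ _) le_q.
  by rewrite size_map leq_exp2l // leq_mul2l le orbT.
have [/size0nil fs0|fs0] := posnP (size fs).
  have [a _] : exists a : S, true by case: x x0 {ex} => // a; exists a.
  exists [:: a]; split=> //; last by rewrite /word_bound expn_gt0 expn_gt0.
  by rewrite fs0 => g h [].
have [f0 _] : exists f : morphism S D, true.
  by case: (fs) fs0 => // f ? _; exists f.
pose F j := letter_image (nth f0 fs j).
have fin j : j < size fs -> List.In (nth f0 fs j) fs by exact: nth_In.
have tm j : j < size fs -> total_marked (F j).
  by move=> /fin/marked_fs/total_marked_morphism.
have sm j : j < size fs -> \sum_a size (F j a) <= c.
  by move=> /fin/sum_letters_le.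
have [|j|y [y0 ey sy]] := @short_solution S D (size fs) c (F 0) F x (tm 0 fs0)
  (fun j => tm j (ltn_ord j)) (sm 0 fs0) (fun j => sm j (ltn_ord j)).
- exact/eqP.
- by rewrite /F -!morphism_ext; move/(EqS_nth f0 _ fs0)/(_ _ (ltn_ord j)): ex.
exists y; split; first exact/eqP.
  apply/(EqS_nth f0 _ fs0) => j lt; rewrite !morphism_ext.
  by have := ey (Ordinal lt).
apply: leq_trans sy _;
  apply: leq_trans (solution_bound_mono le_q (leqnn c) le_k).
rewrite /solution_bound; apply: leq_pow => //; rewrite ?expn_gt0 //.
by apply: leq_pow => //; rewrite ltnS leq_addr.
Qed.

Lemma verdictP : verdict c <-> EqS_trivial fs.
Proof.
rewrite /verdict sum_nat_eq0; split=> [/forallP none x|triv].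
  split=> [ex|->]; last first.
    by move=> g h _ _; rewrite /Eq !morphism_ext.
  have [//|/eqP x0] := eqVneq x [::].
  have [y [y0 ey lt]] := small_solution x0 ex.
  have := none (Ordinal lt); rewrite /= eqb0 => /negP[].
  by apply/test_word.
apply/forallP => m; rewrite /= eqb0; apply/negP=> tm.
have [x Ex] := test_decode tm; move: tm; rewrite Ex => /test_word[x0 ex].
by apply: x0; apply/triv.
Qed.
End Bounded.

Theorem corollary2 :
  exists p : murec 1,
    forall (Sigma Delta : finType) (S : seq (morphism Sigma Delta)),
      (forall f : morphism Sigma Delta, List.In f S -> marked f) ->
      (EqS_trivial S -> murec_eval p [tuple encode_instance S] 1) /\
      (~ EqS_trivial S -> murec_eval p [tuple encode_instance S] 0).
Proof.
have [p hp] := recursive_verdict.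
exists p => Sigma Delta S mS; have := hp [tuple encode_instance S].
have := verdictP mS; rewrite [nth _ _ _]/=; case: (verdict _) => -[vt tv] ev.
  by split=> // /(_ (vt isT)).
by split=> // /tv.
Qed.
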